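(* Let $G$ be a graph that is both a modular graph and a partial cube, with at least three vertices and with $\Theta$-classes $E_1,\ldots,E_d$. Then \begin{align*} SWW_3(G) &= \frac{3|V(G)|-6}{8}\sum_{i=1}^d n_i^0n_i^1+\frac{|V(G)|-2}{4}\sum_{i=1}^{d-1}\sum_{j=i+1}^d\left(n_{ij}^{00}n_{ij}^{11}+n_{ij}^{01}n_{ij}^{10}\right)\\ &\quad+\frac18\sum_{i=1}^d\left(n_i^0n_i^1(n_i^1-1)+n_i^1n_i^0(n_i^0-1)\right)\\ &\quad+\frac14\sum_{i=1}^{d-1}\sum_{j=i+1}^d\Big(3n_{ij}^{00}n_{ij}^{01}n_{ij}^{10}+3n_{ij}^{00}n_{ij}^{01}n_{ij}^{11}+3n_{ij}^{00}n_{ij}^{10}n_{ij}^{11}+3n_{ij}^{01}n_{ij}^{10}n_{ij}^{11}\\ &\qquad+n_{ij}^{00}n_{ij}^{11}(n_{ij}^{11}-1)+n_{ij}^{01}n_{ij}^{10}(n_{ij}^{10}-1)+n_{ij}^{10}n_{ij}^{01}(n_{ij}^{01}-1)+n_{ij}^{11}n_{ij}^{00}(n_{ij}^{00}-1)\Big). \end{align*}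
   Context: Graphs are finite, simple, connected; $d(u,v)$ is the shortest-path distance. A median of vertices $u,v,w$ is a vertex lying on a shortest $u,v$-path, a shortest $u,w$-path and a shortest $v,w$-path; $G$ is modular if every triple of vertices has at least one median. For nonempty $S\subseteq V(G)$, the Steiner distance $d(S)$ is the minimum number of edges of a connected subgraph whose vertex set contains $S$, and $SWW_3(G)=\frac12\sum_{S\subseteq V(G),|S|=3}d(S)+\frac12\sum_{S\subseteq V(G),|S|=3}d(S)^2$. A partial cube is a graph isomorphic to an isometric subgraph of a hypercube. Two edges $u_1v_1$, $u_2v_2$ are in relation $\Theta$ if $d(u_1,u_2)+d(v_1,v_2)\ne d(u_1,v_2)+d(v_1,u_2)$; in a partial cube $\Theta$ is an equivalence relation whose classes are the $\Theta$-classes, and for each $\Theta$-class $E_i$ the graph $G-E_i$ has exactly two connected components, denoted $U_i$ and $U_i'$. Set $n_i^0=|V(U_i)|$, $n_i^1=|V(U_i')|$, and for $i\ne j$: $n_{ij}^{00}=|V(U_i)\cap V(U_j)|$, $n_{ij}^{01}=|V(U_i)\cap V(U_j')|$, $n_{ij}^{10}=|V(U_i')\cap V(U_j)|$, $n_{ij}^{11}=|V(U_i')\cap V(U_j')|$. *)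

(* Defs.v *)
From HB Require Import structures.
From mathcomp Require Import all_boot all_order all_algebra.

Set Implicit Arguments.
Unset Strict Implicit.
Unset Printing Implicit Defensive.

Import Order.TTheory GRing.Theory Num.Theory.

Record sgraph := SGraph {
  vertex :> finType;
  adj : rel vertex;
  adj_sym : symmetric adj;
  adj_irrefl : irreflexive adj }.

Arguments adj {G} : rename.

Definition edges (G : sgraph) : {set {set G}} :=
  [set [set uv.1; uv.2] | uv : G * G & adj uv.1 uv.2].

Definition connected (G : sgraph) : bool :=
  [forall u : G, forall v : G, connect adj u v].

Definition components (G : sgraph) : {set {set G}} :=
  equivalence_partition (connect adj) [set: G].

(* Minimal length of a walk from u to v. Distances between connected vertices *)
(* are smaller than #|G|; the value is #|G| if there is no walk.              *)
Definition dist (G : sgraph) (u v : G) : nat :=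
  \big[minn/#|G|]_(k < #|G| |
    [exists p : k.-tuple G, path adj u p && (last u p == v)]) k.

Definition shortest_path (G : sgraph) (u v : G) (p : seq G) : bool :=
  [&& path adj u p, last u p == v & size p == dist u v].

Definition on_shortest_path (G : sgraph) (u v m : G) : Prop :=
  exists p : seq G, shortest_path u v p /\ m \in u :: p.

Definition median (G : sgraph) (u v w m : G) : Prop :=
  [/\ on_shortest_path u v m, on_shortest_path u w m
    & on_shortest_path v w m].

Definition modular (G : sgraph) : Prop :=
  forall u v w : G, exists m : G, median u v w m.

(* A subgraph is given by its vertex set W and its edge set F. *)
Definition is_subgraph (G : sgraph) (W : {set G}) (F : {set {set G}}) : bool :=
  (F \subset edges G) && [forall e in F, e \subset W].

Section GraphOf.
Variables (G : sgraph) (W : {set G}) (F : {set {set G}}).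

Definition sub_adj : rel {x : G | x \in W} :=
  fun x y => (x != y) && ([set val x; val y] \in F).

Lemma sub_adj_sym : symmetric sub_adj.
Proof. by move=> x y; rewrite /sub_adj eq_sym setUC. Qed.

Lemma sub_adj_irrefl : irreflexive sub_adj.
Proof. by move=> x; rewrite /sub_adj eqxx. Qed.

Definition graph_of : sgraph := SGraph sub_adj_sym sub_adj_irrefl.

End GraphOf.

Section DelEdges.
Variables (G : sgraph) (F : {set {set G}}).

Definition del_adj : rel G :=
  fun x y => adj x y && ([set x; y] \notin F).

Lemma del_adj_sym : symmetric del_adj.
Proof. by move=> x y; rewrite /del_adj adj_sym setUC. Qed.

Lemma del_adj_irrefl : irreflexive del_adj.
Proof. by move=> x; rewrite /del_adj adj_irrefl. Qed.

Definition del_edges : sgraph := SGraph del_adj_sym del_adj_irrefl.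

End DelEdges.

(* The default value #|edges G| is attained by G itself when G is connected, *)
(* and bounds the number of edges of every subgraph.                         *)
Definition steiner (G : sgraph) (S : {set G}) : nat :=
  \big[minn/#|edges G|]_(H : {set G} * {set {set G}} |
    [&& is_subgraph H.1 H.2, connected (graph_of H.1 H.2) & S \subset H.1])
    #|H.2|.

Definition SWW3 (G : sgraph) : rat :=
  (1 / 2 * \sum_(S : {set G} | #|S| == 3%N) (steiner S)%:R
   + 1 / 2 * \sum_(S : {set G} | #|S| == 3%N) (steiner S)%:R ^+ 2)%R.

Section Hypercube.
Variable n : nat.

Definition cube_adj : rel {ffun 'I_n -> bool} :=
  fun x y => #|[set i | x i != y i]| == 1.

Lemma cube_adj_sym : symmetric cube_adj.
Proof.
move=> x y; rewrite /cube_adj; congr (_ == _); apply: eq_card => i.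
by rewrite !inE eq_sym.
Qed.

Lemma cube_adj_irrefl : irreflexive cube_adj.
Proof.
move=> x; rewrite /cube_adj (_ : [set _ | _] = set0) ?cards0 //.
by apply/setP=> i; rewrite !inE eqxx.
Qed.

Definition hypercube : sgraph := SGraph cube_adj_sym cube_adj_irrefl.

End Hypercube.

Definition isomorphic (G H : sgraph) : Prop :=
  exists f : G -> H, bijective f /\ forall u v, adj (f u) (f v) = adj u v.

(* Connectedness ensures that dist is a genuine distance in the subgraph. *)
Definition isometric_subgraph (G : sgraph) (W : {set G}) (F : {set {set G}}) :
    Prop :=
  [/\ is_subgraph W F, connected (graph_of W F)
    & forall x y : graph_of W F, dist x y = dist (val x) (val y)].

Definition partial_cube (G : sgraph) : Prop :=
  exists (n : nat) (W : {set hypercube n}) (F : {set {set hypercube n}}),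
    isometric_subgraph W F /\ isomorphic G (graph_of W F).

(* For edges, the condition does not depend on the labelling of the ends. *)
Definition Theta (G : sgraph) (e f : {set G}) : bool :=
  [exists u1 : G, exists v1 : G, exists u2 : G, exists v2 : G,
    [&& e == [set u1; v1], f == [set u2; v2]
      & dist u1 u2 + dist v1 v2 != dist u1 v2 + dist v1 u2]].

Definition Theta_classes (G : sgraph) : {set {set {set G}}} :=
  equivalence_partition (@Theta G) (edges G).

Definition two_components (G : sgraph) (F : {set {set G}}) (U U' : {set G}) :
    Prop :=
  U != U' /\ components (del_edges F) = [set U; U'].

(* Main.v *)
(* Fix an isometric embedding of G into a hypercube. The Theta-classes are    *)
(* the coordinates that are not constant on G, and U i, U' i are the two      *)
(* sides of the corresponding coordinate. A connected subgraph containing S   *)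
(* needs an edge in each coordinate that is not constant on S; for three      *)
(* vertices, shortest paths to a median, which is the coordinatewise          *)
(* majority, use exactly one such edge each. So the Steiner distance of a     *)
(* triple S is the number of classes that cut S, its square counts the pairs  *)
(* of classes that both cut S, and it remains to count the triples cut by one *)
(* or by two given classes, by inclusion-exclusion.                           *)

Require Import Defs.
From HB Require Import structures.
From mathcomp Require Import all_boot all_order all_algebra.
From mathcomp Require Import ring zify.

Set Implicit Arguments.
Unset Strict Implicit.
Unset Printing Implicit Defensive.

Import Order.TTheory GRing.Theory Num.Theory.

(** Under an isometric embedding into a hypercube each edge changes exactly one coordinate, and two
    edges are in relation $\Theta$ exactly when they change the same one ([Theta_coord]). So the
    classes $E_i$ correspond to the coordinates that vary on [G], and [U i], [U' i] are the two
    sides of such a coordinate ([two_components_sides], [card_split_coords]).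

    A connected subgraph containing [S] has an edge in every coordinate that varies on [S], which
    bounds [steiner S] from below ([split_coords_le_steiner]). For a triple, shortest paths from a
    median reach this bound ([modular_steiner3]). Hence $d(S)=\sum_i x_i$, where $x_i\in\{0,1\}$
    tells whether $S$ meets both sides of $E_i$, and $(d(S)+d(S)^2)/2=\sum_i x_i+\sum_{i<j}x_ix_j$.
    Summing over triples leaves two counts, [sum_crosses] and [sum_crosses2], in terms of the sizes
    of sides and of their intersections; the stated formula is a rearrangement of them. *)

Lemma bigminn_le (I : finType) (P : pred I) (F : I -> nat) D i :
  P i -> \big[minn/D]_(j | P j) F j <= F i.
Proof.
move=> Pi; have := mem_index_enum i; elim: (index_enum I) => // j s IH.
rewrite inE big_cons => /predU1P[<-|/IH le_i]; first by rewrite Pi geq_minl.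
by case: ifP => // _; apply: leq_trans (geq_minr _ _) le_i.
Qed.

Lemma bigminn_le_default (I : finType) (P : pred I) (F : I -> nat) D :
  \big[minn/D]_(j | P j) F j <= D.
Proof.
by elim/big_rec: _ => // i m _ mD; apply: leq_trans (geq_minr _ _) mD.
Qed.

Lemma bigminn_attained (I : finType) (P : pred I) (F : I -> nat) D :
  \big[minn/D]_(j | P j) F j = D \/
  exists2 i, P i & \big[minn/D]_(j | P j) F j = F i.
Proof.
elim/big_rec: _ => [|i m Pi IH]; first by left.
by rewrite /minn; case: ifP => _ //; right; exists i.
Qed.

Lemma connect_invariant (T : finType) (e : rel T) (A : eqType) (g : T -> A) :
  (forall x y, e x y -> g x = g y) -> forall x y, connect e x y -> g x = g y.
Proof.
move=> eg x y /connectP[p + ->]; elim: p x => //= z p IH x /andP[/eg-> ].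
exact: IH.
Qed.

Lemma set2_eq (T : finType) (a b c d : T) :
  [set a; b] = [set c; d] -> (a = c /\ b = d) \/ (a = d /\ b = c).
Proof.
move=> eqS.
have: a \in [set c; d] by rewrite -eqS set21.
have: b \in [set c; d] by rewrite -eqS set22.
have: c \in [set a; b] by rewrite eqS set21.
have: d \in [set a; b] by rewrite eqS set22.
by move=> /set2P[]d_eq /set2P[]c_eq /set2P[]b_eq /set2P[]a_eq; subst; auto.
Qed.

(** * Edges, shortest paths and distances *)

Lemma mem_edges (G : sgraph) (u v : G) : ([set u; v] \in edges G) = adj u v.
Proof.
apply/imsetP/idP => [[[x y]] |auv]; last by exists (u, v); rewrite ?inE.
by rewrite inE /= => axy /set2_eq[][-> ->]; rewrite // adj_sym.
Qed.

Lemma edgesP (G : sgraph) (e : {set G}) :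
  reflect (exists u v, adj u v /\ e = [set u; v]) (e \in edges G).
Proof.
apply: (iffP imsetP) => [[[u v]]|[u [v [auv ->]]]]; last first.
  by exists (u, v); rewrite ?inE.
by rewrite inE /= => auv ->; exists u, v.
Qed.

Lemma dist_le_size (G : sgraph) (u : G) (p : seq G) :
  path adj u p -> dist u (last u p) <= size p.
Proof.
move=> up; case: (ltnP (size p) #|G|) => [ltp|]; last first.
  by apply: leq_trans; apply: bigminn_le_default.
apply: (@bigminn_le _ _ (fun k : 'I_#|G| => nat_of_ord k) _ (Ordinal ltp)).
by apply/existsP; exists (in_tuple p); rewrite up eqxx.
Qed.

Lemma dist_attained (G : sgraph) (u v : G) :
  connected G -> exists p, shortest_path u v p.
Proof.
move=> /forallP/(_ u)/forallP/(_ v)/connectP[q /shortenP[p up Up _] ->].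
(* A duplicate-free path has fewer than [#|G|] edges, which rules out the default value of the
   minimum. *)
have ltp : size p < #|G|.
  by have := max_card (mem (u :: p)); rewrite (card_uniqP Up).
have := dist_le_size up; set w := last u p.
rewrite /dist; set P := (X in \big[minn/_]_(k < _ | X k) _).
case: (bigminn_attained P (fun k : 'I_#|G| => nat_of_ord k) #|G|) => [->|].
  by move=> /leq_ltn_trans/(_ ltp); rewrite ltnn.
move=> [k /existsP[t /andP[ut /eqP lt]] dk] _.
by exists t; rewrite /shortest_path ut lt eqxx /= /dist -/P dk size_tuple eqxx.
Qed.

Lemma dist_between (G : sgraph) (u v m : G) :
  on_shortest_path u v m -> dist u m + dist m v <= dist u v.
Proof.
case=> p [/and3P[up /eqP lp /eqP <-] mp].
case/splitPl: mp up lp => p1 p2 l1; rewrite cat_path last_cat l1 size_cat.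
move=> /andP[u1 u2] l2.
by rewrite -{1}l1 -{}l2; apply: leq_add; apply: dist_le_size.
Qed.

Lemma dist_morph_le (G H : sgraph) (f : G -> H) (u v : G) :
  connected G -> (forall x y, adj x y -> adj (f x) (f y)) ->
  dist (f u) (f v) <= dist u v.
Proof.
move=> /dist_attained-/(_ u v)[p /and3P[up /eqP <- /eqP <-]] fadj.
rewrite -(size_map f) -last_map; apply: dist_le_size.
by rewrite path_map; apply: sub_path up.
Qed.

Lemma dist_iso (G H : sgraph) (f : G -> H) (u v : G) :
  connected G -> connected H -> bijective f ->
  (forall x y, adj (f x) (f y) = adj x y) -> dist (f u) (f v) = dist u v.
Proof.
move=> cG cH [g fK gK] fadj; apply/eqP; rewrite eqn_leq dist_morph_le //=.
  rewrite -{1}[u]fK -{1}[v]fK; apply: dist_morph_le => // x y.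
  by rewrite -{1}[x]gK -{1}[y]gK fadj.
by move=> x y; rewrite fadj.
Qed.

(** * Hamming distance and isometric embeddings *)

Definition hamming n (x y : {ffun 'I_n -> bool}) := #|[set k | x k != y k]|.

Lemma hamming_sum n (x y : {ffun 'I_n -> bool}) :
  hamming x y = \sum_k (x k != y k).
Proof.
by rewrite /hamming -sum1_card big_mkcond; under eq_bigr do rewrite inE.
Qed.

Lemma hamming_triangle n (x y z : {ffun 'I_n -> bool}) :
  hamming x z <= hamming x y + hamming y z.
Proof.
rewrite !hamming_sum -big_split /=; apply: leq_sum => k _.
by case: (x k) (y k) (z k) => [] [] [].
Qed.

Lemma hamming_eq0 n (x y : {ffun 'I_n -> bool}) : hamming x y = 0 -> x = y.
Proof.
move/eqP; rewrite cards_eq0 => /eqP/setP xy; apply/ffunP => k.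
by have := xy k; rewrite !inE => /negbFE/eqP.
Qed.

Lemma hamming_le_size n (x : hypercube n) (p : seq (hypercube n)) :
  path adj x p -> hamming x (last x p) <= size p.
Proof.
elim: p x => [|y p IH] x /=.
  move=> _; rewrite /hamming (_ : [set _ | _] = set0) ?cards0 //.
  by apply/setP => k; rewrite !inE eqxx.
move=> /andP[/eqP xy yp]; apply: leq_trans (hamming_triangle _ y _) _.
by rewrite {1}/hamming xy add1n ltnS IH.
Qed.

Lemma hamming_path n (x y : hypercube n) :
  exists p : seq (hypercube n),
    [/\ path adj x p, last x p = y & size p = hamming x y].
Proof.
move: {2}(hamming x y) (erefl (hamming x y)) => m.
elim: m x => [|m IH] x xy.
  by exists [::]; rewrite xy; split=> //; apply: hamming_eq0.
have [k kD] : exists k, k \in [set k | (x : {ffun _}) k != (y : {ffun _}) k].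
  by apply/set0Pn; rewrite -cards_eq0 -/(hamming x y) xy.
(* Flipping one coordinate where [x] and [y] differ gives a neighbour of [x] that is one step nearer
   to [y]. *)
pose z : {ffun 'I_n -> bool} := [ffun t => if t == k then y k else x t].
have xk : x k != y k by rewrite inE in kD.
have axz : @adj (hypercube n) x z.
  apply/eqP; rewrite -(cards1 k); congr #|pred_of_set _|.
  apply/setP => t; rewrite !inE ffunE.
  by case: (eqVneq t k) => [->|]; rewrite ?eqxx.
have zy : hamming z y = m.
  apply/eqP; rewrite -eqSS -xy [X in _ == X](cardsD1 k) inE xk add1n eqSS.
  apply/eqP; congr #|pred_of_set _|.
  apply/setP => t; rewrite !inE ffunE.
  by case: (eqVneq t k) => [->|]; rewrite ?eqxx.
have [p [zp lp sp]] := IH z zy.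
exists ((z : hypercube n) :: p).
by split; rewrite ?xy /= ?sp ?zy ?lp //; apply/andP.
Qed.

Lemma dist_hypercube n (x y : hypercube n) : dist x y = hamming x y.
Proof.
have cQ : connected (hypercube n).
  apply/forallP => u; apply/forallP => v; apply/connectP.
  by have [p [up lp _]] := hamming_path u v; exists p.
apply/eqP; rewrite eqn_leq; apply/andP; split.
  by have [p [xp <- <-]] := hamming_path x y; apply: dist_le_size.
have [p /and3P[xp /eqP <- /eqP <-]] := dist_attained x y cQ.
exact: hamming_le_size.
Qed.

Definition isometric_embedding (G : sgraph) n
    (phi : G -> {ffun 'I_n -> bool}) :=
  forall u v, dist u v = hamming (phi u) (phi v).

Lemma partial_cube_embedding (G : sgraph) :
  connected G -> partial_cube G ->
  exists n (phi : G -> {ffun 'I_n -> bool}), isometric_embedding phi.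
Proof.
move=> cG [n [W [F [[_ cH dH] [f [fbij fadj]]]]]].
exists n, (fun u => val (f u)) => u v.
by rewrite -dist_hypercube -dH (dist_iso _ _ cG cH fbij fadj).
Qed.

(** If [x] and [y] agree at [k] but [z] differs there, then [k] adds 2 to the left sum and 0 to the
    right one. Every other coordinate obeys the triangle inequality, so the left sum would be
    strictly larger. *)
Lemma hamming_between n (x y z : {ffun 'I_n -> bool}) :
  hamming x z + hamming z y <= hamming x y -> forall k, x k = y k -> z k = x k.
Proof.
move=> xzy k xyk; apply/eqP; apply: contraLR xzy => zxk.
rewrite -ltnNge !hamming_sum -big_split /= (bigD1 k) //=.
rewrite [X in _ < X](bigD1 k) //=.
rewrite -xyk eqxx (eq_sym (x k)) zxk add0n add1n addSn ltnS; apply: leqW.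
by apply: leq_sum => t _; case: (x t) (y t) (z t) => [] [] [].
Qed.

(** * Coordinates that vary on a set, and the lower bound on the Steiner distance *)

Definition split_coords (T : finType) n (phi : T -> {ffun 'I_n -> bool})
    (S : {set T}) : {set 'I_n} :=
  [set k | [exists x in S, exists y in S, phi x k != phi y k]].

Lemma split_coordsP (T : finType) n (phi : T -> {ffun 'I_n -> bool})
    (S : {set T}) k :
  reflect (exists x y, [/\ x \in S, y \in S & phi x k != phi y k])
    (k \in split_coords phi S).
Proof.
rewrite inE; apply: (iffP exists_inP) => [[x xS /exists_inP[y yS xy]]|].
  by exists x, y.
by case=> x [y [xS yS xy]]; exists x => //; apply/exists_inP; exists y.
Qed.

Lemma split_coords2 (T : finType) n (phi : T -> {ffun 'I_n -> bool}) u v k :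
  (k \in split_coords phi [set u; v]) = (phi u k != phi v k).
Proof.
apply/split_coordsP/idP => [[x [y [/set2P[]-> /set2P[]->]]]|uv].
- by rewrite eqxx.
- by [].
- by rewrite eq_sym.
- by rewrite eqxx.
by exists u, v; rewrite set21 set22.
Qed.

Lemma split_coords3 (T : finType) n (phi : T -> {ffun 'I_n -> bool}) u v w k :
  (k \in split_coords phi [set u; v; w]) =
  ~~ ((phi u k == phi v k) && (phi u k == phi w k)).
Proof.
apply/split_coordsP/idP => [[x [y [xS yS]]]|].
  apply: contra => /andP[/eqP uv /eqP uw].
  have phiu z : z \in [set u; v; w] -> phi z k = phi u k.
    by rewrite !inE -orbA => /or3P[]/eqP->.
  by rewrite !phiu.
by rewrite negb_and => /orP[]uv; [exists u, v | exists u, w];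
  rewrite !inE !eqxx !orbT.
Qed.

Section Embedded.
Variables (G : sgraph) (n : nat) (phi : G -> {ffun 'I_n -> bool}).
Hypotheses (Gconn : connected G) (phi_iso : isometric_embedding phi).

Lemma adj_coord u v :
  adj u v -> exists k, forall t, (phi u t != phi v t) = (t == k).
Proof.
move=> auv; suff /cards1P[k uvk] : hamming (phi u) (phi v) == 1.
  by exists k => t; have /setP/(_ t) := uvk; rewrite !inE.
have up : path adj u [:: v] by rewrite /= auv.
rewrite -phi_iso eqn_leq (dist_le_size up) lt0n /=.
have [p /and3P[_ /eqP lp /eqP <-]] := dist_attained u v Gconn.
by case: p lp auv => //= ->; rewrite adj_irrefl.
Qed.

(** If no edge of [F] changed the coordinate [k], connectedness would make [k] constant on [S]; and
    each edge changes only one coordinate. The map [h] lets the same argument serve [G] itself and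
    the vertex subtype of a subgraph. *)
Lemma card_split_coords_le (T : finType) (r : rel T) (h : T -> G)
    (F : {set {set G}}) (S : {set G}) :
  F \subset edges G -> (forall x y, r x y -> [set h x; h y] \in F) ->
  (forall x y, connect r x y) -> {in S, forall u, exists x, h x = u} ->
  #|split_coords phi S| <= #|F|.
Proof.
move=> FE rF rconn hS.
have sub : split_coords phi S \subset \bigcup_(e in F) split_coords phi e.
  apply/subsetP => k /split_coordsP[u [v [uS vS]]]; apply: contraR => kF.
  have [x <-] := hS u uS; have [y <-] := hS v vS; apply/eqP.
  apply: (connect_invariant (g := fun x => phi (h x) k) _ (rconn x y)).
  move=> a b /rF abF; apply/eqP; apply: contraR kF => abk.
  by apply/bigcupP; exists [set h a; h b] => //; rewrite split_coords2.
apply: leq_trans (subset_leq_card sub) _; rewrite -[X in _ <= X]sum1_card.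
elim/big_rec2: _ => [|e m A eF le_m]; first by rewrite cards0.
have /edgesP[u [v [auv ->]]] := subsetP FE e eF.
have [k uvk] := adj_coord auv.
rewrite (_ : split_coords phi _ = [set k]).
  by apply: leq_trans (leq_card_setU _ _) _; rewrite cards1 leq_add2l.
by apply/setP => t; rewrite split_coords2 uvk inE.
Qed.

Lemma split_coords_le_steiner (S : {set G}) :
  #|split_coords phi S| <= steiner S.
Proof.
rewrite /steiner; set P := (X in \big[minn/_]_(H | X H) _).
case: (bigminn_attained P (fun H => #|H.2|) #|edges G|) => [->|].
  (* The default value [#|edges G|] is handled by taking the connected graph [G] itself as the
     subgraph. *)
  apply: (@card_split_coords_le _ adj id) => // [x y|x y|u _].
  - by rewrite mem_edges.
  - by have /forallP/(_ x)/forallP := Gconn.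
  - by exists u.
move=> [[W F] /= /and3P[/andP[FE _] /= Hconn SW] ->].
apply: (@card_split_coords_le _ (@sub_adj G W F) val) => //
  [x y /andP[]//|x y|u uS].
  by have /forallP/(_ x)/forallP := Hconn.
by exists (Sub u (subsetP SW u uS)).
Qed.

End Embedded.

(** * Upper bound on the Steiner distance of a triple *)

(* Rooted connectedness, avoiding the vertex subtype of [graph_of]. *)
Definition spans (G : sgraph) (r : G) (W : {set G}) (F : {set {set G}}) :=
  [/\ is_subgraph W F, r \in W &
    {in W, forall x, connect [rel x y | [set x; y] \in F] r x}].

Lemma spans_connected (G : sgraph) (r : G) W F :
  spans r W F -> connected (graph_of W F).
Proof.
case=> /andP[/subsetP FE /forall_inP FW] rW rconn.
pose r0 : graph_of W F := Sub r rW.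
have lift (x : graph_of W F) : connect (@adj (graph_of W F)) r0 x.
  have /connectP[p] := rconn _ (valP x); rewrite -[r]/(val r0).
  elim: p r0 => [|y p IH] z /=; first by move=> _ /val_inj->.
  move=> /andP[zyF yp] lp.
  have yW : y \in W by apply: (subsetP (FW _ zyF)); rewrite set22.
  apply: (connect_trans (connect1 _) (IH (Sub y yW) yp lp)).
  rewrite /= /sub_adj zyF andbT; apply/eqP => zy.
  by have := FE _ zyF; rewrite mem_edges zy adj_irrefl.
apply/forallP => x; apply/forallP => y.
apply: connect_trans (lift y).
by rewrite (sym_connect_sym (@adj_sym _)).
Qed.

Lemma spans_step (G : sgraph) (r : G) W F x y :
  spans r W F -> x \in W -> adj x y -> spans r (y |: W) ([set x; y] |: F).
Proof.
case=> /andP[/subsetP FE /forall_inP FW] rW rconn xW axy.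
have mono u v : connect [rel x y | [set x; y] \in F] u v ->
    connect [rel a b | [set a; b] \in [set x; y] |: F] u v.
  by apply: connect_sub => a b /= abF; apply: connect1; rewrite /= setU1r.
split; last 2 first.
- by rewrite setU1r.
- move=> z /setU1P[->|/rconn/mono//].
  apply: connect_trans (mono _ _ (rconn x xW)) (connect1 _).
  by rewrite /= setU11.
apply/andP; split.
  by rewrite subUset sub1set mem_edges axy; apply/subsetP.
apply/forall_inP => e /setU1P[->|/FW eW].
  by rewrite subUset !sub1set setU11 setU1r.
exact: subset_trans eW (subsetUr _ _).
Qed.

Lemma spans_path (G : sgraph) (r : G) W F x p :
  spans r W F -> x \in W -> path adj x p ->
  exists W' F', [/\ spans r W' F', W \subset W', last x p \in W'
    & #|F'| <= #|F| + size p].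
Proof.
elim: p W F x => [|y p IH] W F x sWF xW /=; first by exists W, F; rewrite addn0.
case/andP=> /(spans_step sWF xW)/IH-/(_ y (setU11 _ _)) IHy /IHy.
move=> [W' [F' [sWF' WW' lW' le_F']]]; exists W', F'; split=> //.
  exact: subset_trans (subsetUr _ _) WW'.
apply: leq_trans le_F' _; rewrite addnS -addSn leq_add2r -add1n cardsU1.
by rewrite leq_add2r leq_b1.
Qed.

(** The union of shortest paths from [m] to the three vertices is connected. It is grown from the
    single vertex [m], one path at a time; shared edges only lower the count. *)
Lemma steiner3_le (G : sgraph) (m u v w : G) :
  connected G -> steiner [set u; v; w] <= dist m u + dist m v + dist m w.
Proof.
move=> cG.
have s0 : spans m [set m] set0.
  split; rewrite ?set11 //; last by move=> x /set1P->; apply: connect0.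
  by rewrite /is_subgraph sub0set; apply/forall_inP => e; rewrite inE.
have [p1 /and3P[mp1 /eqP l1 /eqP <-]] := dist_attained m u cG.
have [p2 /and3P[mp2 /eqP l2 /eqP <-]] := dist_attained m v cG.
have [p3 /and3P[mp3 /eqP l3 /eqP <-]] := dist_attained m w cG.
have [W1 [F1 [s1 W01 uW1 F1le]]] := spans_path s0 (set11 m) mp1.
have mW1 : m \in W1 by case: s1.
have [W2 [F2 [s2 W12 uW2 F2le]]] := spans_path s1 mW1 mp2.
have mW2 : m \in W2 by case: s2.
have [W3 [F3 [s3 W23 uW3 F3le]]] := spans_path s2 mW2 mp3.
rewrite l1 in uW1; rewrite l2 in uW2; rewrite l3 in uW3.
apply: (@leq_trans #|F3|); last by move: F1le; rewrite cards0; lia.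
rewrite /steiner; set P := (X in \big[minn/_]_(H | X H) _).
apply: (@bigminn_le _ P (fun H => #|H.2|) #|edges G| (W3, F3)); rewrite /P /=.
rewrite (spans_connected s3); case: s3 => -> _ _ /=.
rewrite !subUset !sub1set uW3 andbT (subsetP W23 _ uW2) andbT.
by apply: (subsetP W23); apply: (subsetP W12).
Qed.

(** By [hamming_between], a median agrees with any two of the three vertices wherever these two
    agree, so it is their coordinatewise majority. A coordinate that varies on the triple thus
    separates the median from exactly one vertex, and any other coordinate from none. *)
Lemma modular_steiner3 (G : sgraph) n (phi : G -> {ffun 'I_n -> bool}) u v w :
  connected G -> modular G -> isometric_embedding phi ->
  steiner [set u; v; w] = #|split_coords phi [set u; v; w]|.
Proof.
move=> cG mG phi_iso; apply/eqP; rewrite eqn_leq split_coords_le_steiner // andbT.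
have [m [/dist_between uv /dist_between uw /dist_between vw]] := mG u v w.
apply: leq_trans (steiner3_le m u v w cG) _.
rewrite !phi_iso in uv uw vw *.
have muv := hamming_between uv; have muw := hamming_between uw.
have mvw := hamming_between vw.
rewrite !hamming_sum -!big_split /= -sum1_card [leqRHS]big_mkcond /=.
apply: leq_sum => k _; rewrite split_coords3.
move: (muv k) (muw k) (mvw k).
by case: (phi u k) (phi v k) (phi w k) (phi m k) => [] [] [] [] //;
  do ?[move/(_ erefl) => //|move=> _].
Qed.

(** * Theta-classes and their components as coordinates and their sides *)

Section ThetaClasses.
Variables (G : sgraph) (n : nat) (phi : G -> {ffun 'I_n -> bool}).
Hypotheses (Gconn : connected G) (phi_iso : isometric_embedding phi).

(** A coordinate where [u] and [v] agree, or [x] and [y] agree, adds the same amount to both sums.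
    Only a common direction [k = l] escapes this: there one sum receives 0 and the other 2. *)
Lemma dist_swap_edges u v x y k l :
  (forall t, (phi u t != phi v t) = (t == k)) ->
  (forall t, (phi x t != phi y t) = (t == l)) ->
  (dist u x + dist v y != dist u y + dist v x) = (k == l).
Proof.
move=> uvk xyl; rewrite !phi_iso !hamming_sum -!big_split /=.
case: (eqVneq k l) => [kl|kl].
  rewrite -{l}kl in xyl.
  rewrite (bigD1 k) //= [X in _ != X](bigD1 k) //=.
  rewrite [X in _ + X](eq_bigr
    (fun t => (phi u t != phi y t) + (phi v t != phi x t))); last first.
    move=> t tk; move: (uvk t) (xyl t); rewrite (negbTE tk).
    by move=> /negbFE/eqP-> /negbFE/eqP->.
  rewrite eqn_add2r; move: (uvk k) (xyl k); rewrite eqxx.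
  by case: (phi u k) (phi v k) (phi x k) (phi y k) => [] [] [] [].
apply: negbTE; rewrite negbK; apply/eqP; apply: eq_bigr => t _.
move: (uvk t) (xyl t); case: (eqVneq t k) => [->|_].
  by rewrite (negbTE kl) => _ /negbFE/eqP->.
by move=> /negbFE/eqP-> _; rewrite addnC.
Qed.

Lemma Theta_coord u v x y k l :
  (forall t, (phi u t != phi v t) = (t == k)) ->
  (forall t, (phi x t != phi y t) = (t == l)) ->
  Theta [set u; v] [set x; y] = (k == l).
Proof.
move=> uvk xyl; apply/existsP/idP => [[u1 /existsP[v1]]|kl]; last first.
  exists u; apply/existsP; exists v; apply/existsP; exists x.
  by apply/existsP; exists y; rewrite !eqxx (dist_swap_edges uvk xyl) kl.
move=> /existsP[u2 /existsP[v2 /and3P[/eqP uv /eqP xy]]].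
(* The witnesses may name the ends in the other order; [split_coords2] reads the changed coordinates
   off the unordered edge. *)
rewrite (@dist_swap_edges _ _ _ _ k l) // => t.
  by rewrite -uvk -!split_coords2 uv.
by rewrite -xyl -!split_coords2 xy.
Qed.

Definition cut_by (k : 'I_n) (F : {set {set G}}) :=
  forall u v, adj u v -> ([set u; v] \in F) = (phi u k != phi v k).

Lemma Theta_class_cut F :
  F \in Theta_classes G ->
  exists k, cut_by k F /\ exists u v, phi u k != phi v k.
Proof.
case/imsetP => e /edgesP[u [v [auv ->]]] ->.
have [k uvk] := adj_coord Gconn phi_iso auv.
exists k; split; last by exists u, v; rewrite uvk.
move=> x y axy; have [l xyl] := adj_coord Gconn phi_iso axy.
by rewrite inE mem_edges axy /= (Theta_coord uvk xyl) xyl.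
Qed.

Lemma edge_Theta_class u v :
  adj u v -> exists2 F, F \in Theta_classes G & [set u; v] \in F.
Proof.
move=> auv; have [k uvk] := adj_coord Gconn phi_iso auv.
exists [set f in edges G | Theta [set u; v] f].
  by apply/imsetP; exists [set u; v]; rewrite ?mem_edges.
by rewrite inE mem_edges auv (Theta_coord uvk uvk) eqxx.
Qed.

Lemma split_coords_Theta_class S k :
  k \in split_coords phi S -> exists2 F, F \in Theta_classes G & cut_by k F.
Proof.
case/split_coordsP => x [y [_ _ xy]].
have [u /existsP[v /andP[auv uvk]]] :
    exists u, [exists v, adj u v && (phi u k != phi v k)].
  apply/existsP; apply: contraR xy => noedge; apply/eqP.
  apply: (connect_invariant (g := fun x => phi x k) _ _); last first.
    by have /forallP/(_ x)/forallP := Gconn; apply.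
  move=> a b ab; apply/eqP; apply: contraR noedge => abk.
  by apply/existsP; exists a; apply/existsP; exists b; rewrite ab.
have [F FT uvF] := edge_Theta_class auv; exists F => //.
have [l [lF _]] := Theta_class_cut FT.
have [t uvt] := adj_coord Gconn phi_iso auv.
suff -> : k = l by [].
by move: uvF uvk; rewrite (lF _ _ auv) !uvt => /eqP-> /eqP->.
Qed.

(** Edges outside [F] preserve coordinate [k], so it is constant on each component. As it takes both
    values and there are only two components, each of them is a full side. The bit [b] records which
    side is called [U]. *)
Lemma two_components_sides k F (U U' : {set G}) :
  cut_by k F -> (exists u v, phi u k != phi v k) -> two_components F U U' ->
  exists b, U = [set x | phi x k == b] /\ U' = [set x | phi x k != b].
Proof.
move=> kF [u [v uv]] [_ compE].
have comp_const W : W \in [set U; U'] -> exists b, {in W, forall x, phi x k = b}.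
  rewrite -compE => /imsetP[x _ ->]; exists (phi x k) => y; rewrite !inE /=.
  move=> xy; apply/esym; move: xy.
  apply: (connect_invariant (g := fun x => phi x k)).
  by move=> a b /andP[ab]; rewrite (kF _ _ ab) negbK => /eqP.
have cover x : (x \in U) || (x \in U').
  have : [set y in [set: G] | connect (@adj (del_edges F)) x y] \in [set U; U'].
    by rewrite -compE; apply: imset_f; rewrite inE.
  by move=> /set2P[]<-; rewrite !inE connect0 ?orbT.
have [b Ub] := comp_const U (set21 _ _).
have [b' U'b'] := comp_const U' (set22 _ _).
have bb' : b' = ~~ b.
  have := cover u; have := cover v; move: uv.
  have vals x : x \in U \/ x \in U' -> phi x k = b \/ phi x k = b'.
    by case=> [/Ub|/U'b'] ->; auto.
  move=> uv /orP/vals + /orP/vals.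
  case: b b' {Ub U'b' vals} uv => [] [] // uv [] v_eq [] u_eq;
    by rewrite u_eq v_eq in uv.
exists b; split; apply/setP => x; rewrite inE.
  apply/idP/eqP => [/Ub//|xb]; have /orP[//|/U'b'] := cover x.
  by rewrite xb bb'; case: (b).
apply/idP/idP => [/U'b'->|xb]; first by rewrite bb'; case: (b).
by have /orP[/Ub xb'|//] := cover x; rewrite xb' eqxx in xb.
Qed.

Lemma split_sides S k b (U U' : {set G}) :
  U = [set x | phi x k == b] -> U' = [set x | phi x k != b] ->
  (k \in split_coords phi S) = ~~ (S \subset U) && ~~ (S \subset U').
Proof.
move=> -> ->; apply/split_coordsP/andP => [[x [y [xS yS xy]]]|].
  split; apply: contra xy => /subsetP SU; have := SU x xS; have := SU y yS;
    rewrite !inE; first by move=> /eqP-> /eqP->.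
  by case: (phi x k) (phi y k) (b) => [] [] [].
move=> [/subsetPn[x xS xb] /subsetPn[y yS yb]]; exists x, y; split=> //.
by move: xb yb; rewrite !inE; case: (phi x k) (phi y k) (b) => [] [] [].
Qed.

Lemma card_split_coords d (E : 'I_d -> {set {set G}}) (U U' : 'I_d -> {set G})
    (S : {set G}) :
  injective E -> [set E i | i : 'I_d] = Theta_classes G ->
  (forall i, two_components (E i) (U i) (U' i)) ->
  #|split_coords phi S|
  = #|[set i | ~~ (S \subset U i) && ~~ (S \subset U' i)]|.
Proof.
move=> Einj EE UU'.
have ET i : E i \in Theta_classes G by rewrite -EE imset_f.
(* [c i] is the coordinate of the class [E i]. It remains to see that [c] is injective and reaches
   every coordinate that varies on [S]. *)
have [c cP] := fin_all_exists (fun i => Theta_class_cut (ET i)).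
have side i : (c i \in split_coords phi S)
    = ~~ (S \subset U i) && ~~ (S \subset U' i).
  have [cE cuv] := cP i.
  by have [b []] := two_components_sides cE cuv (UU' i); apply: split_sides.
have cutE k F F' : F \in Theta_classes G -> F' \in Theta_classes G ->
    cut_by k F -> cut_by k F' -> F = F'.
  case/imsetP=> e _ -> /imsetP[e' _ ->] kF kF'; apply/setP => f.
  case: (boolP (f \in edges G)) => [/edgesP[u [v [auv ->]]]|fE].
    by rewrite kF // kF'.
  by rewrite !inE (negbTE fE).
have cinj : injective c.
  move=> i j cij; apply: Einj; apply: (cutE (c i)) => //; first by case: (cP i).
  by rewrite cij; case: (cP j).
rewrite -(card_imset _ cinj); apply: eq_card => k; apply/idP/imsetP.
  move=> kS; have [F FT kF] := split_coords_Theta_class kS.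
  have /imsetP[i _ FE] : F \in [set E i | i : 'I_d] by rewrite EE.
  have [cE _] := cP i.
  (* Both [k] and [c i] are the one coordinate changed by some edge of [E i]. *)
  suff kc : k = c i by exists i; rewrite // inE -side -kc.
  move: FT; rewrite FE => /imsetP[e /edgesP[x [y [axy eE]]] EiE].
  have [t xyt] := adj_coord Gconn phi_iso axy.
  have exy : [set x; y] \in E i.
    by rewrite EiE eE inE mem_edges axy (Theta_coord xyt xyt) eqxx.
  rewrite FE in kF; move: exy (exy); rewrite {1}(kF _ _ axy) (cE _ _ axy) !xyt.
  by move=> /eqP-> /eqP->.
by case=> i; rewrite inE -side => ? ->.
Qed.

End ThetaClasses.

(** * Counting the triples cut by one or two classes *)

Local Open Scope ring_scope.

Lemma sqr_sum_ord (R : comPzRingType) d (x : 'I_d -> R) :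
  (\sum_i x i) ^+ 2
  = \sum_i x i ^+ 2 + 2 * \sum_(i < d) \sum_(j < d | (i < j)%N) x i * x j.
Proof.
rewrite expr2 mulr_suml.
have -> : \sum_i x i * (\sum_j x j)
    = \sum_(i < d) x i ^+ 2 + \sum_(i < d) \sum_(j < d | (i < j)%N) x i * x j
      + \sum_(i < d) \sum_(j < d | (j < i)%N) x i * x j.
  rewrite -!big_split; apply: eq_bigr => i _ /=.
  rewrite mulr_sumr (bigD1 i) //= (bigID (fun j : 'I_d => (i < j)%N)) /=.
  rewrite addrA expr2.
  congr (_ + _ + _); apply: eq_bigl => j.
    by rewrite andb_idl // => ij; apply: contraTneq ij => ->; rewrite ltnn.
  by rewrite -leqNgt ltn_neqAle.
rewrite [X in _ + _ + X](exchange_big_dep xpredT) //= mulrDl mul1r -addrA.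
congr (_ + (_ + _)).
by apply: eq_bigr => i _; apply: eq_bigr => j _; rewrite mulrC.
Qed.

(** The polynomial form over the rationals lets [field] settle the counting identities below. *)
Lemma bin3_rat m : 'C(m, 3)%:R = m%:R * (m%:R - 1) * (m%:R - 2) / 6 :> rat.
Proof.
have /(congr1 (fun k => k%:R : rat)) := bin_ffact m 3.
rewrite natrM => /(canRL (mulfK _)) -> //; congr (_ / _).
case: m => [|[|m]]; rewrite ?mul0r //.
rewrite !ffactnS ffactn0 muln1 /= !natrM -[m.+2%:R]natr1 -[m.+1%:R]natr1.
ring.
Qed.

Lemma sum_subset3 (T : finType) (A : {set T}) :
  \sum_(S : {set T} | #|S| == 3%N) (S \subset A)%:R
  = #|A|%:R * (#|A|%:R - 1) * (#|A|%:R - 2) / 6 :> rat.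
Proof.
rewrite -bin3_rat -cards_draws -sum1_card natr_sum [in RHS]big_mkcond.
rewrite [in LHS]big_mkcond; apply: eq_bigr => S _; rewrite inE andbC.
by case: (_ == _) => //=; case: (_ \subset _).
Qed.

(** For nonempty [S] this indicates that [S] meets both [A] and its complement; the empty set gets
    -1. Being linear in containment indicators, its sums reduce to [sum_subset3]. *)
Definition crosses (T : finType) (A S : {set T}) : rat :=
  1 - (S \subset A)%:R - (S \subset ~: A)%:R.

Lemma crossesE (T : finType) (A S : {set T}) : #|S| == 3%N ->
  crosses A S = (~~ (S \subset A) && ~~ (S \subset ~: A))%:R.
Proof.
move=> S3; rewrite /crosses; case: (boolP (S \subset A)) => SA; last first.
  by case: (_ \subset _); rewrite ?subr0 ?subrr.
case: (boolP (S \subset ~: A)) => SA'; last by rewrite subr0 subrr.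
have : S \subset A :&: ~: A by rewrite subsetI SA.
by rewrite setICr subset0 => /eqP S0; rewrite S0 cards0 in S3.
Qed.

Lemma sum_crosses (T : finType) (A : {set T}) :
  \sum_(S : {set T} | #|S| == 3%N) crosses A S
  = (#|A|%:R * #|~: A|%:R * (#|T|%:R - 2)) / 2.
Proof.
have oneE (S : {set T}) : 1 = (S \subset [set: T])%:R :> rat by rewrite subsetT.
rewrite /crosses !sumrB; under eq_bigr => S _ do rewrite (oneE S).
rewrite !sum_subset3 cardsT -(cardsC A) natrD; by field.
Qed.

(** A triple cut both ways either has its vertices in three different quadrants, or has two in one
    quadrant and the third in the opposite one. The proof instead expands the product into nine
    containment indicators and sums each with [sum_subset3]. *)
Lemma sum_crosses2 (T : finType) (A B : {set T}) :
  let a := #|A :&: B|%:R : rat in let b := #|A :&: ~: B|%:R : rat in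
  let c := #|~: A :&: B|%:R : rat in let e := #|~: A :&: ~: B|%:R : rat in
  \sum_(S : {set T} | #|S| == 3%N) crosses A S * crosses B S
  = a * b * c + a * b * e + a * c * e + b * c * e
    + (a * e * (a + e - 2) + b * c * (b + c - 2)) / 2.
Proof.
move=> a b c e.
have sub2 (S A' B' : {set T}) :
    (S \subset A')%:R * (S \subset B')%:R = (S \subset A' :&: B')%:R :> rat.
  by rewrite subsetI -natrM mulnb.
under eq_bigr => S _.
  rewrite (_ : _ * _ = (S \subset [set: T])%:R
      - (S \subset A)%:R - (S \subset ~: A)%:R - (S \subset B)%:R
      - (S \subset ~: B)%:R + (S \subset A :&: B)%:R + (S \subset A :&: ~: B)%:R
      + (S \subset ~: A :&: B)%:R + (S \subset ~: A :&: ~: B)%:R); last first.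
    by rewrite -!sub2 subsetT /crosses [true%:R]mulr1n; ring.
  over.
rewrite !(big_split, sumrN) /= !sum_subset3 cardsT -(cardsC A).
have cardA (X : {set T}) (Y : {set T}) :
    #|X|%:R = #|X :&: Y|%:R + #|X :&: ~: Y|%:R :> rat.
  by rewrite -natrD -(cardsID Y X) setDE.
rewrite natrD (cardA B A) (cardA (~: B) A) (cardA A B) (cardA (~: A) B).
rewrite ![_ :&: A]setIC ![_ :&: ~: A]setIC -/a -/b -/c -/e.
by field.
Qed.

(** * Assembling the formula *)

Lemma two_componentsC (G : sgraph) n (phi : G -> {ffun 'I_n -> bool}) F U U' :
  connected G -> isometric_embedding phi -> F \in Theta_classes G ->
  two_components F U U' -> U' = ~: U.
Proof.
move=> cG phi_iso FT UU'; have [k [kF uv]] := Theta_class_cut cG phi_iso FT.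
have [b [-> ->]] := two_components_sides kF uv UU'.
by apply/setP => x; rewrite !inE.
Qed.

Theorem theorem5p3 (G : sgraph) (d : nat) (E : 'I_d -> {set {set G}})
    (U U' : 'I_d -> {set G})
    (Gconn : connected G) (Gmod : modular G) (Gcube : partial_cube G)
    (G3 : (3 <= #|G|)%N)
    (Einj : injective E) (EE : [set E i | i : 'I_d] = Theta_classes G)
    (UU' : forall i, two_components (E i) (U i) (U' i)) :
  let n0 (i : 'I_d) : rat := #|U i|%:R in
  let n1 (i : 'I_d) : rat := #|U' i|%:R in
  let n00 (i j : 'I_d) : rat := #|U i :&: U j|%:R in
  let n01 (i j : 'I_d) : rat := #|U i :&: U' j|%:R in
  let n10 (i j : 'I_d) : rat := #|U' i :&: U j|%:R in
  let n11 (i j : 'I_d) : rat := #|U' i :&: U' j|%:R in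
  SWW3 G =
    (3 * #|G|%:R - 6) / 8 * (\sum_(i < d) n0 i * n1 i)
  + (#|G|%:R - 2) / 4 *
      (\sum_(i < d) \sum_(j < d | (i < j)%N)
         (n00 i j * n11 i j + n01 i j * n10 i j))
  + 1 / 8 * (\sum_(i < d)
      (n0 i * n1 i * (n1 i - 1) + n1 i * n0 i * (n0 i - 1)))
  + 1 / 4 * (\sum_(i < d) \sum_(j < d | (i < j)%N)
      (3 * n00 i j * n01 i j * n10 i j + 3 * n00 i j * n01 i j * n11 i j
     + 3 * n00 i j * n10 i j * n11 i j + 3 * n01 i j * n10 i j * n11 i j
     + n00 i j * n11 i j * (n11 i j - 1) + n01 i j * n10 i j * (n10 i j - 1)
     + n10 i j * n01 i j * (n01 i j - 1)
     + n11 i j * n00 i j * (n00 i j - 1))).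
Proof.
move=> n0 n1 n00 n01 n10 n11.
have [n [phi phi_iso]] := partial_cube_embedding Gconn Gcube.
have U'E i : U' i = ~: U i.
  by apply: (two_componentsC Gconn phi_iso _ (UU' i)); rewrite -EE imset_f.
have steinerE (S : {set G}) : #|S| == 3%N ->
    (steiner S)%:R = \sum_(i < d) crosses (U i) S.
  move=> S3; have [u [v [w SE]]] : exists u v w, S = [set u; v; w].
    have [u uS] : exists u, u \in S by apply/set0Pn; rewrite -cards_eq0 (eqP S3).
    move: (S3); rewrite (cardsD1 u) uS eqSS => /cards2P[v [w [_ SE]]].
    by exists u, v, w; rewrite -(setD1K uS) SE setUA.
  rewrite {1}SE (modular_steiner3 _ _ _ Gconn Gmod phi_iso) -SE.
  rewrite (card_split_coords Gconn phi_iso _ Einj EE UU') -sum1_card natr_sum.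
  rewrite big_mkcond; apply: eq_bigr => i _ /=.
  by rewrite inE U'E crossesE //; case: ifP.
have crosses_sqr i (S : {set G}) : #|S| == 3%N ->
    crosses (U i) S ^+ 2 = crosses (U i) S.
  by move=> S3; rewrite crossesE //; case: (_ && _); rewrite ?expr0n ?expr1n.
rewrite /SWW3 -mulrDr -big_split /=.
under eq_bigr => S S3.
  rewrite steinerE // sqr_sum_ord (eq_bigr _ (fun i _ => crosses_sqr i S S3)).
  (* Since each [crosses (U i) S] is its own square, the diagonal of $d(S)^2$ repeats $d(S)$; the
     resulting factor 2 cancels the 1/2 of [SWW3]. *)
  rewrite (_ : _ + (_ + _) = 2 * (\sum_i crosses (U i) S
    + \sum_(i < d) \sum_(j < d | (i < j)%N) crosses (U i) S * crosses (U j) S));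
    last by ring.
  over.
rewrite -mulr_sumr mulrA divfK // mul1r big_split exchange_big /=.
under eq_bigr do rewrite sum_crosses.
rewrite [X in _ + X]exchange_big /=.
under [X in _ + X]eq_bigr do rewrite exchange_big /=.
under [X in _ + X]eq_bigr do under eq_bigr do rewrite sum_crosses2.
(* Writing [#|G|] as the sum of the two sides, or of the four quadrants, turns the comparison into a
   polynomial identity for each [i] and each pair [i < j]. *)
have splitn i : #|G|%:R = n0 i + n1 i by rewrite /n0 /n1 U'E -natrD cardsC.
have splitn2 i j : #|G|%:R = n00 i j + n01 i j + n10 i j + n11 i j.
  rewrite (splitn i) /n0 /n1 /n00 /n01 /n10 /n11 !U'E -addrA -!natrD.
  by rewrite -!setDE !cardsID.
(* This pairs the two sums over single classes and the two sums over pairs of classes. *)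
rewrite -[RHS]addrA [RHS]addrACA !mulr_sumr.
congr (_ + _); rewrite -big_split; apply: eq_bigr => i _ /=.
  by rewrite (splitn i) /n0 /n1 !U'E; field.
rewrite !mulr_sumr -big_split; apply: eq_bigr => j _ /=.
by rewrite (splitn2 i j) /n00 /n01 /n10 /n11 !U'E; field.
Qed.
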